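(* Let $X$ be a $T_0$ space and $X^{\omega\text{-}w}=P_H(\mathsf{WD}_\omega(X))$. Then the pair $\langle X^{\omega\text{-}w},\eta_X\rangle$, where $\eta_X:X\to X^{\omega\text{-}w}$, $x\mapsto\overline{\{x\}}$, is the $\omega$-well-filtered reflection of $X$.
   Context: A subset of a space is saturated if it is an intersection of open sets. A family of sets is filtered if it is nonempty and any two members contain a third member of the family. A $T_0$ space $Y$ is $\omega$-well-filtered if for every countable filtered family $\{K_i : i<\omega\}$ of nonempty compact saturated subsets of $Y$ and every open $U\subseteq Y$, $\bigcap_{i<\omega}K_i\subseteq U$ implies $K_{i_0}\subseteq U$ for some $i_0<\omega$. $\mathsf{WD}_\omega(X)$ is the set of all closed $A\subseteq X$ such that for every continuous map $f:X\to Y$ to an $\omega$-well-filtered space $Y$ there is a unique $y_A\in Y$ with $\overline{f(A)}=\overline{\{y_A\}}$. $P_H(\mathsf{WD}_\omega(X))$ is the set $\mathsf{WD}_\omega(X)$ with the lower Vietoris topology, whose open sets are exactly the sets $\Diamond U=\{A\in\mathsf{WD}_\omega(X) : A\cap U\neq\emptyset\}$ with $U$ open in $X$. An $\omega$-well-filtered reflection of $X$ is a pair $\langle\widetilde X,\mu\rangle$ consisting of an $\omega$-well-filtered space $\widetilde X$ and a continuous map $\mu:X\to\widetilde X$ such that for every continuous map $f:X\to Y$ to an $\omega$-well-filtered space $Y$ there is a unique continuous map $f^*:\widetilde X\to Y$ with $f^*\circ\mu=f$. *)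

(* Defs.v *)
From HB Require Import structures.
From mathcomp Require Import all_boot all_order.
From mathcomp Require Import boolp classical_sets topology.

Set Implicit Arguments.
Unset Strict Implicit.
Unset Printing Implicit Defensive.

Local Open Scope classical_set_scope.

Definition saturated (Y : topologicalType) (A : set Y) : Prop :=
  exists2 F : set (set Y), F `<=` open & A = \bigcap_(U in F) U.

Definition filtered_family (T : Type) (F : set (set T)) : Prop :=
  F !=set0 /\
  forall A B, F A -> F B -> exists2 C, F C & C `<=` A `&` B.

Definition omega_well_filtered (Y : topologicalType) : Prop :=
  kolmogorov_space Y /\
  forall K : nat -> set Y,
    filtered_family (range K) ->
    (forall i, [/\ K i !=set0, compact (K i) & saturated (K i)]) ->
    forall U : set Y, open U ->
      \bigcap_i K i `<=` U -> exists i0, K i0 `<=` U.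

(* The test spaces Y range over the universe of [topologicalType], which is
   also the universe of X; membership is a Prop, so the set stays there. *)
Definition WDomega (X : topologicalType) : set (set X) :=
  [set A | closed A /\
     forall Y : topologicalType, omega_well_filtered Y ->
     forall f : X -> Y, continuous f ->
       exists! y : Y, closure (f @` A) = closure [set y]].
Arguments WDomega X : clear implicits.

(* The square of the Sierpinski space, with its upper sets as open sets. It
   serves only to show that the members of WDomega X are irreducible, hence
   that the sets Diamond U are closed under binary intersection. *)
Definition sierpinski2 : Type := (bool * bool)%type.

HB.instance Definition _ := Choice.on sierpinski2.

Definition sierpinski2_le (p q : sierpinski2) : bool :=
  (p.1 ==> q.1) && (p.2 ==> q.2).

Definition sierpinski2_open : set (set sierpinski2) :=
  [set D | forall p q, sierpinski2_le p q -> D p -> D q].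

Lemma sierpinski2_openT : sierpinski2_open setT.
Proof. by []. Qed.

Lemma sierpinski2_openI : setI_closed sierpinski2_open.
Proof.
by move=> A B oA oB p q pq [Ap Bp]; split; [exact: oA pq Ap|exact: oB pq Bp].
Qed.

Lemma sierpinski2_open_bigU (I : Type) (F : I -> set sierpinski2) :
  (forall i, sierpinski2_open (F i)) -> sierpinski2_open (\bigcup_i F i).
Proof. by move=> oF p q pq [i _ Fip]; exists i => //; exact: oF pq Fip. Qed.

HB.instance Definition _ := isOpenTopological.Build sierpinski2
  sierpinski2_openT sierpinski2_openI sierpinski2_open_bigU.

Lemma sierpinski2_openE (D : set sierpinski2) : open D = sierpinski2_open D.
Proof. by []. Qed.

Lemma sierpinski2_kolmogorov : kolmogorov_space sierpinski2.
Proof.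
have up_open p : open [set q | sierpinski2_le p q].
  move=> q r; rewrite /sierpinski2_le /=.
  by case: p q r => [[] []] [[] []] [[] []].
have up_nbhs p : [set q | sierpinski2_le p q] \in nbhs p.
  rewrite inE; apply: open_nbhs_nbhs; split; first exact: up_open.
  by rewrite /sierpinski2_le /= !implybb.
move=> p q pq; have [lpq|nlpq] := boolP (sierpinski2_le p q).
  exists [set r | sierpinski2_le q r]; right; split=> //.
  rewrite inE /= => lqp; move: pq lpq lqp; rewrite /sierpinski2_le.
  by case: p q => [[] []] [[] []].
exists [set r | sierpinski2_le p r]; left; split=> //.
by rewrite inE /=; exact/negP.
Qed.

Lemma filtered_finite (T : finType) (K : nat -> set T) :
  filtered_family (range K) -> exists i, K i `<=` \bigcap_j K j.
Proof.
move=> [_ dirK].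
have [i Ki] : exists i, forall p, p \in enum T -> K i p -> (\bigcap_j K j) p.
  elim: (enum T) => [|p s [i IH]]; first by exists 0.
  have [Kp|/existsNP[j /not_implyP[_ nKjp]]] := pselect ((\bigcap_j K j) p).
    by exists i => q; rewrite inE => /predU1P[->//|/IH].
  have [_ [k _ <-] Ksub] :=
    dirK (K i) (K j) (ex_intro2 _ _ i I erefl) (ex_intro2 _ _ j I erefl).
  exists k => q; rewrite inE => /predU1P[-> /Ksub[_ /nKjp]//|qs /Ksub[Kiq _]].
  exact: IH qs Kiq.
by exists i => p; apply: Ki; rewrite mem_enum.
Qed.

Lemma sierpinski2_omega_well_filtered : omega_well_filtered sierpinski2.
Proof.
split; first exact: sierpinski2_kolmogorov.
move=> K Kdir _ U _ KU; have [i Ki] := @filtered_finite (bool * bool)%type K Kdir.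
by exists i; exact: subset_trans KU.
Qed.

Lemma closure_meets_open (Y : topologicalType) (B U : set Y) :
  open U -> closure B `&` U !=set0 -> B `&` U !=set0.
Proof. by move=> oU [y [By Uy]]; apply: By; exact: open_nbhs_nbhs. Qed.

Lemma closure1_meets_open (Y : topologicalType) (y : Y) (U : set Y) :
  open U -> closure [set y] `&` U !=set0 -> U y.
Proof. by move=> oU /(closure_meets_open oU)[_ [-> ]]. Qed.

Lemma WDomega_irreducible (X : topologicalType) (A U V : set X) :
  WDomega X A -> open U -> open V ->
  A `&` U !=set0 -> A `&` V !=set0 -> A `&` (U `&` V) !=set0.
Proof.
move=> [_ WA] oU oV [u [Au Uu]] [v [Av Vv]].
pose f (x : X) : sierpinski2 := (`[< U x >], `[< V x >]).
have cf : continuous f.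
  apply/continuousP => D oD.
  rewrite openE => x Dfx; pose W1 := if `[< U x >] then U else setT.
  pose W2 := if `[< V x >] then V else setT.
  have oW : open (W1 `&` W2).
    by apply: openI; rewrite /W1 /W2; case: ifP => _ //; exact: openT.
  apply: (@filterS _ _ _ (W1 `&` W2)).
    move=> z [W1z W2z]; apply: (oD (f x)) => //.
    rewrite /sierpinski2_le /f /=; move: W1z W2z; rewrite /W1 /W2.
    by case: ifP => _ /= => [/asboolT ->|_]; case: ifP => _ //= /asboolT ->.
  apply: open_nbhs_nbhs; split => //; split; rewrite /W1 /W2.
    by case: ifP => // /asboolP.
  by case: ifP => // /asboolP.
have [y [fAy _]] := WA _ sierpinski2_omega_well_filtered f cf.
have meet D x : open D -> A x -> D (f x) -> D y.
  move=> oD Ax Dfx; apply: closure1_meets_open oD _; rewrite -fAy.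
  by exists (f x); split => //; apply: subset_closure; exists x.
have y1 : y.1.
  apply: (meet [set p | is_true p.1] u) => //; last exact/asboolP.
  by move=> [[] p2] [[] q2].
have y2 : y.2.
  apply: (meet [set p | is_true p.2] v) => //; last exact/asboolP.
  by move=> [p1 []] [q1 []] //=; rewrite /sierpinski2_le /= andbF.
have oD : open [set p : sierpinski2 | is_true (p.1 && p.2)].
  by move=> [[] []] [[] []].
have [|_ [[x Ax <-] /= /andP[/asboolP Ux /asboolP Vx]]] :=
  @closure_meets_open _ (f @` A) _ oD.
  by rewrite fAy; exists y; split; [exact: subset_closure|rewrite /= y1 y2].
by exists x.
Qed.

Definition PH_WDomega (X : topologicalType) : Type :=
  {A : set X | A \in WDomega X}.

HB.instance Definition _ (X : topologicalType) := Choice.on (PH_WDomega X).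

Section LowerVietoris.
Variable X : topologicalType.

Definition Diamond (U : set X) : set (PH_WDomega X) :=
  [set A | sval A `&` U !=set0].

Definition lower_Vietoris_open : set (set (PH_WDomega X)) :=
  [set Diamond U | U in open].

Lemma lower_Vietoris_openT : lower_Vietoris_open setT.
Proof.
exists setT; first exact: openT.
apply/seteqP; split=> // -[A WA] _; rewrite /Diamond /= setIT.
apply/set0P/negP => /eqP A0; move: (WA); rewrite inE A0 => -[_].
case/(_ _ sierpinski2_omega_well_filtered (fun=> (true, true)))=> [|y [e _]].
  exact: cst_continuous.
have /closure_meets_open : closure (@set0 sierpinski2) `&` setT !=set0.
  rewrite -(image_set0 (fun _ : X => (true, true) : sierpinski2)) e setIT.
  by exists y; exact: subset_closure.
by case/(_ openT) => ? [].
Qed.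

Lemma lower_Vietoris_openI : setI_closed lower_Vietoris_open.
Proof.
move=> _ _ [U oU <-] [V oV <-]; exists (U `&` V); first exact: openI.
apply/seteqP; split=> [A [x [Ax [Ux Vx]]]|[A WA] [AU AV]].
  by split; exists x.
by apply: WDomega_irreducible => //; exact/set_mem.
Qed.

Lemma lower_Vietoris_open_bigU (I : Type) (F : I -> set (PH_WDomega X)) :
  (forall i, lower_Vietoris_open (F i)) ->
  lower_Vietoris_open (\bigcup_i F i).
Proof.
move=> oF; exists (\bigcup_(U in [set U | open U /\ exists i, F i = Diamond U]) U).
  by apply: bigcup_open => U [].
apply/seteqP; split=> [A [x [Ax [U [oU [i Fi]] Ux]]]|A [i _]].
  by exists i => //; rewrite Fi; exists x.
have [U oU Fi] := oF i; rewrite -Fi => -[x [Ax Ux]].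
by exists x; split => //; exists U => //; split => //; exists i.
Qed.

HB.instance Definition _ := isOpenTopological.Build (PH_WDomega X)
  lower_Vietoris_openT lower_Vietoris_openI lower_Vietoris_open_bigU.

Lemma PH_WDomega_openE : @open (PH_WDomega X) = lower_Vietoris_open.
Proof. by []. Qed.

Lemma closure1_WDomega (x : X) : closure [set x] \in WDomega X.
Proof.
rewrite inE; split; first exact: closed_closure.
move=> Y [T0 _] f cf.
have key : closure (f @` closure [set x]) = closure [set f x].
  apply/seteqP; split; last first.
    by apply: closureS => _ ->; exists x => //; exact: subset_closure.
  rewrite [X in _ `<=` X](closure_id _).1; last exact: closed_closure.
  apply: closureS => _ [z xz <-] B /cf /xz [_ [-> Bfx]].
  by exists (f x).
exists (f x); split => // y; rewrite key => e; apply/eqP; apply: contraPT e.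
have sep p q (N : set Y) : nbhs p N -> ~ N q ->
    closure [set p] = closure [set q] -> False.
  move=> Np nNq e; have : closure [set q] p by rewrite -e; exact: subset_closure.
  by move=> /(_ N Np)[_ [->]].
move=> /T0[N [[]|[]]]; rewrite !inE => Np Nq e; first exact: sep Np Nq e.
exact: sep Np Nq (esym e).
Qed.

Definition eta (x : X) : PH_WDomega X :=
  exist _ (closure [set x]) (closure1_WDomega x).

End LowerVietoris.

Definition omega_well_filtered_reflection
    (X Xt : topologicalType) (mu : X -> Xt) : Prop :=
  [/\ omega_well_filtered Xt, continuous mu &
      forall Y : topologicalType, omega_well_filtered Y ->
      forall f : X -> Y, continuous f ->
        exists! fstar : Xt -> Y, continuous fstar /\ fstar \o mu = f].

(* Main.v *)
Require Import Defs.
From mathcomp Require Import all_boot all_order.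
From mathcomp Require Import boolp classical_sets topology.

Set Implicit Arguments.
Unset Strict Implicit.
Unset Printing Implicit Defensive.

Local Open Scope classical_set_scope.

(** The proof rests on two facts about WD-sets, a WD-set of Z being a member of
    [WDomega Z], that is a closed set whose image under every continuous map to
    an omega-well-filtered space has the closure of a point as its closure.

    The first is that a T0 space Z in which every WD-set is the closure of a
    point is omega-well-filtered ([omega_well_filtered_of_generic_points]).
    Suppose the intersection of a countable filtered family of compact
    saturated sets K_i lies in an open set U that contains no K_i. By
    compactness and Zorn's lemma there is a closed set A, disjoint from U, that
    is minimal among the closed sets meeting every K_i (this is the topological
    Rudin lemma, [minimal_closed_meeting]). Such an A is a WD-set
    ([WDomega_minimal_closed]): for f : Z -> Y continuous with Y
    omega-well-filtered, the upward closures of the sets f(K_i `&` A) form a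
    countable filtered family of compact saturated sets, all meeting the closure
    of f(A), so some point y of that closure lies in all of them; minimality of
    A then forces A to be contained in the preimage of the closure of y. So A
    is the closure of a point z. As the K_i are saturated and meet A, z lies in
    all of them, hence in U; but z lies in A, which is disjoint from U.

    The second is that [PH_WDomega X] has this property
    ([PH_WDomega_generic_points]): a WD-set AA of [PH_WDomega X] is the closure
    of the point given by the closure of the union of the members of AA. This
    closure is a WD-set of X because every f : X -> Y extends to
    [PH_WDomega X], and the extension sends AA to a set with the same closure
    as the image of the union.

    The extension of f sends A to the unique generic point of f(A). It is
    continuous since the preimage of V is [Diamond (f @^-1` V)], and it is the
    only one because every continuous g on [PH_WDomega X] must send A to a
    generic point of (g \o eta)(A) ([extension_generic_point]). *)

(** * Generic points *)

(** A reformulation of [closure B = closure [set y]] by open sets (see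
    [generic_pointE]), the form in which it combines with images, preimages and
    the sets [Diamond U]. *)
Definition generic_point (Y : topologicalType) (B : set Y) (y : Y) : Prop :=
  forall U : set Y, open U -> B `&` U !=set0 <-> U y.

Lemma closure1P (Y : topologicalType) (y z : Y) :
  closure [set y] z <-> forall U : set Y, open U -> U z -> U y.
Proof.
split=> [yz U oU Uz|yz N]; first by apply: closure1_meets_open oU _; exists z.
rewrite nbhsE => -[U [oU Uz] UN].
by exists y; split=> //; apply: UN; exact: yz Uz.
Qed.

Lemma kolmogorov_open_inj (Y : topologicalType) (y z : Y) :
  kolmogorov_space Y -> (forall U : set Y, open U -> U y <-> U z) -> y = z.
Proof.
move=> T0 yz; apply: contrapT => /eqP /T0[N [[]|[]]]; rewrite !inE nbhsE.
  by move=> [U [oU Uy] UN] /(_ (UN _ ((yz U oU).1 Uy))).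
by move=> [U [oU Uz] UN] /(_ (UN _ ((yz U oU).2 Uz))).
Qed.

Lemma generic_pointE (Y : topologicalType) (B : set Y) (y : Y) :
  closure B = closure [set y] <-> generic_point B y.
Proof.
split=> [e U oU|By].
  split=> [[b [Bb Ub]]|Uy].
    apply: closure1_meets_open (oU) _.
    by rewrite -e; exists b; split=> //; exact: subset_closure.
  apply: closure_meets_open (oU) _.
  by rewrite e; exists y; split=> //; exact: subset_closure.
apply/seteqP; split=> z.
  move=> Bz; apply/closure1P => U oU Uz; apply/By => //.
  by apply: closure_meets_open (oU) _; exists z.
move=> /closure1P yz N; rewrite nbhsE => -[U [oU /(yz _ oU) Uy] UN].
by have [b [Bb Ub]] := (By U oU).2 Uy; exists b; split=> //; exact: UN.
Qed.

Lemma generic_point_unique (Y : topologicalType) (B : set Y) (y z : Y) :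
  kolmogorov_space Y -> generic_point B y -> generic_point B z -> y = z.
Proof.
by move=> T0 By Bz; apply: kolmogorov_open_inj => // U oU; rewrite -By ?Bz.
Qed.

Lemma meets_imageP (X Y : Type) (f : X -> Y) (A : set X) (U : set Y) :
  (f @` A) `&` U !=set0 <-> A `&` f @^-1` U !=set0.
Proof.
by split=> [[_ [[x Ax <-] Ux]]|[x [Ax Ux]]]; [exists x|exists (f x); split].
Qed.

(** Target spaces are T0, so generic points are unique and only their existence
    is at stake. *)
Lemma WDomegaP (X : topologicalType) (A : set X) :
  WDomega X A <->
  closed A /\ forall Y : topologicalType, omega_well_filtered Y ->
    forall f : X -> Y, continuous f -> exists y : Y, generic_point (f @` A) y.
Proof.
split=> -[cA WA]; split=> // Y wfY f cf; have [y] := WA Y wfY f cf.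
  by move=> [/generic_pointE fAy _]; exists y.
move=> fAy; exists y; split; first exact/generic_pointE.
by move=> z /generic_pointE; exact: generic_point_unique wfY.1 fAy.
Qed.

(** * Upward closures for the specialization order *)

Definition upset (Y : topologicalType) (B : set Y) : set Y :=
  [set y | exists2 b, B b & closure [set y] b].

Lemma sub_upset (Y : topologicalType) (B : set Y) : B `<=` upset B.
Proof. by move=> b Bb; exists b => //; exact: subset_closure. Qed.

Lemma upsetS (Y : topologicalType) (A B : set Y) :
  A `<=` B -> upset A `<=` upset B.
Proof. by move=> AB y [a /AB Ba ya]; exists a. Qed.

(** A point [y] outside [upset B] is excluded by the complement of its own
    closure, an open set containing [B]. *)
Lemma saturated_upset (Y : topologicalType) (B : set Y) : saturated (upset B).
Proof.
exists [set U | open U /\ B `<=` U]; first by move=> U [].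
apply/seteqP; split=> [y [b Bb /closure1P yb] U [oU BU]|y By].
  by apply: yb => //; exact: BU.
apply: contrapT => nBy; apply: (By (~` closure [set y])) => /=.
  split; first by rewrite openC; exact: closed_closure.
  by move=> b Bb yb; apply: nBy; exists b.
exact: subset_closure.
Qed.

Lemma saturated_closure1 (Y : topologicalType) (K : set Y) (x y : Y) :
  saturated K -> K x -> closure [set y] x -> K y.
Proof.
move=> [F Fo ->] Kx /closure1P yx U FU.
by apply: yx; [exact: Fo|exact: Kx].
Qed.

(** Open sets are upward closed, so an open cover of [B] covers [upset B]. With
    filters: a filter on [upset B] is pushed down to [B], by replacing each of
    its members with the points of [B] below it; a cluster point of the new
    filter is one of the old filter, since a neighbourhood meeting the points
    below [P] meets [P]. *)
Lemma compact_upset (Y : topologicalType) (B : set Y) :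
  compact B -> compact (upset B).
Proof.
move=> cB F PF FB.
pose below (P : set Y) := [set b | B b /\ exists2 p, P p & closure [set p] b].
have fG : Filter (filter_from F below).
  apply: filter_from_filter; first by exists (upset B).
  move=> P Q FP FQ; exists (P `&` Q); first exact: filterI.
  by move=> b [Bb [p [Pp Qp] pb]]; split; split=> //; exists p.
have pG : ProperFilter (filter_from F below).
  apply: filter_from_proper => P FP.
  have [p [Pp [b Bb pb]]] := filter_ex (filterI FP FB).
  by exists b; split=> //; exists p.
have [|b [Bb Gb]] := cB _ pG; first by exists (upset B) => // b [].
exists b; split; first exact: sub_upset.
move=> P N FP; rewrite nbhsE => -[U [oU Ub] UN].
have [|c [[_ [p Pp /closure1P pc]] Uc]] :=
  Gb (below P) U _ (open_nbhs_nbhs (conj oU Ub)); first exact: in_filter_from.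
by exists p; split=> //; apply: UN; exact: pc Uc.
Qed.

(** * Minimal closed sets meeting a family of compact sets *)

(** The traces on [K] of the members of the chain form a filter basis, and
    any cluster point of it lies in each of these closed sets. *)
Lemma compact_meets_bigcap_chain (Z : topologicalType) (K : set Z)
    (F : set (set Z)) :
  compact K -> F !=set0 -> total_on F subset ->
  (forall D, F D -> closed D /\ K `&` D !=set0) ->
  K `&` \bigcap_(D in F) D !=set0.
Proof.
move=> cK F0 Ftot FD.
have fG : Filter (filter_from F (setI K)).
  apply: filter_from_filter => [|P Q FP FQ]; first exact: F0.
  have [PQ|QP] := Ftot _ _ FP FQ; [exists P|exists Q] => // z [Kz Dz].
    by split; split=> //; exact: PQ.
  by split; split=> //; exact: QP.
have pG : ProperFilter (filter_from F (setI K)).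
  by apply: filter_from_proper => D /FD[].
have [|z [Kz Gz]] := cK _ pG; first by have [D FD0] := F0; exists D => // z [].
exists z; split=> // D FD0; apply: (FD _ FD0).1 => N zN.
by have [w [[_ Dw] Nw]] := Gz _ N (in_filter_from _ FD0) zN; exists w.
Qed.

(** The topological Rudin lemma. Zorn's lemma is applied to the open sets [W]
    such that [C `\` W] still meets every [K i]: a maximal one gives a minimal
    closed set, and the union of a chain is handled by compactness. *)
Lemma minimal_closed_meeting (Z : topologicalType) (I : Type) (K : I -> set Z)
    (C : set Z) :
  (forall i, compact (K i)) -> closed C -> (forall i, K i `&` C !=set0) ->
  exists A, [/\ closed A, A `<=` C, forall i, K i `&` A !=set0 &
    forall B, closed B -> B `<=` A -> (forall i, K i `&` B !=set0) -> A `<=` B].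
Proof.
move=> cK cC KC.
pose P := [set W : set Z | open W /\ forall i, K i `&` (C `\` W) !=set0].
have [F PF Ftot|W [[oW KW] Wmax]] := @Zorn_bigcup _ P.
  (* The empty chain has no member to apply compactness to; its union is empty
     and the hypothesis on [C] is what is needed. *)
  have oF : open (\bigcup_(W in F) W) by apply: bigcup_open => W /PF[].
  split=> // i; have [F0|nF0] := pselect (F !=set0); last first.
    have [z [Kz Cz]] := KC i; exists z; split=> //; split=> // -[W FW _].
    by apply: nF0; exists W.
  have [|||z [Kz Fz]] := @compact_meets_bigcap_chain _ (K i)
      [set C `\` W | W in F] (cK i).
  - by have [W FW] := F0; exists (C `\` W); exists W.
  - move=> _ _ [V FV <-] [W FW <-]; have [VW|WV] := Ftot _ _ FV FW.
      by right; exact: setDS.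
    by left; exact: setDS.
  - move=> _ [W FW <-]; have [oW KW] := PF _ FW; split=> //.
    by apply: closedI => //; exact: open_closedC.
  have [W0 FW0] := F0.
  exists z; split=> //; split=> [|[W FW Wz]].
    by have [] : (C `\` W0) z by apply: Fz; exists W0.
  by have [_] : (C `\` W) z by apply: Fz; exists W.
exists (C `\` W); split=> //.
  by apply: closedI => //; exact: open_closedC.
move=> B cB BA KB z [Cz nWz]; apply: contrapT => nBz.
apply: (Wmax (~` B)); last first.
  split; first by rewrite openC.
  move=> i; have [w [Kw Bw]] := KB i; exists w; split=> //.
  by split; [exact: (BA _ Bw).1|move=> /(_ Bw)].
split; first by move=> w Ww Bw; exact: (BA _ Bw).2.
by move=> BW; apply: nWz; exact: BW.
Qed.

Lemma filtered_range (S T : Type) (g : set S -> set T) (K : nat -> set S) :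
  {homo g : A B / A `<=` B} -> filtered_family (range K) ->
  filtered_family (range (g \o K)).
Proof.
move=> gS [_ Kdir]; split; first by exists (g (K 0)); exists 0.
move=> _ _ [i _ <-] [j _ <-].
have [_ [k _ <-] Kk] := Kdir (K i) (K j) (imageP _ I) (imageP _ I).
exists (g (K k)); first by exists k.
by move=> t gt; split; apply: gS gt => s /Kk[].
Qed.

(** The point [y] below comes from the well-filteredness of [Y], applied to the
    complement of the closure of [f @` A]. Lying in the upward closure of
    [f @` (K i `&` A)] for every [i], it makes [A `&` f @^-1` closure [set y]]
    meet every [K i], hence equal to [A] by minimality. *)
Lemma WDomega_minimal_closed (Z : topologicalType) (K : nat -> set Z)
    (A : set Z) :
  filtered_family (range K) -> (forall i, compact (K i)) ->
  closed A -> (forall i, K i `&` A !=set0) ->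
  (forall B, closed B -> B `<=` A -> (forall i, K i `&` B !=set0) -> A `<=` B) ->
  WDomega Z A.
Proof.
move=> Kdir cK cA KA Amin; apply/WDomegaP; split=> // Y [T0 wfY] f cf.
pose Q (C : set Z) := upset (f @` (C `&` A)).
have [y Qy fAy] : exists2 y, (\bigcap_i Q (K i)) y & closure (f @` A) y.
  apply: contrapT => nQ.
  have [||||i] := wfY (Q \o K) _ _ (~` closure (f @` A)).
  - apply: filtered_range Kdir => C D CD; apply: upsetS; apply: image_subset.
    exact: setSI.
  - move=> i; split; last exact: saturated_upset.
      have [z KAz] := KA i; exists (f z); apply: sub_upset; exact: imageP.
    apply: compact_upset; apply: continuous_compact.
      exact: continuous_subspaceT.
    exact: compact_closedI.
  - by rewrite openC; exact: closed_closure.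
  - by move=> y Qy fAy; apply: nQ; exists y.
  have [z [Kz Az]] := KA i; move=> /(_ (f z)); apply.
    by apply: sub_upset; exact: imageP.
  by apply: subset_closure; exact: imageP.
have Afy : A `<=` A `&` f @^-1` closure [set y].
  apply: Amin; [|by move=> z []|].
    apply: closedI => //; have/continuous_closedP := cf.
    by apply; exact: closed_closure.
  move=> i; have [_ [z [Kz Az] <-] yz] := Qy i I.
  by exists z.
exists y => U oU; split=> [[_ [[z /Afy[_ yz] <-] Uz]]|Uy].
  by apply: (closure1P _ _).1 yz _ oU Uz.
by apply: closure_meets_open (oU) _; exists y.
Qed.

(** A violation of well-filteredness would produce a minimal closed set [A]
    outside [U]; its generic point would lie in every [K i], as these are
    saturated, and so in [U]. *)
Lemma omega_well_filtered_of_generic_points (Z : topologicalType) :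
  kolmogorov_space Z ->
  (forall A, WDomega Z A -> exists z, generic_point A z) ->
  omega_well_filtered Z.
Proof.
move=> T0 Zgen; split=> // K Kdir Kcs U oU KU; apply: contrapT => nKU.
have cK i : compact (K i) by have [] := Kcs i.
have [||A [cA AU KA Amin]] := minimal_closed_meeting cK (C := ~` U).
- exact: open_closedC.
- move=> i; apply: contrapT => KiU; apply: nKU; exists i => z Kz.
  by apply: contrapT => nUz; apply: KiU; exists z.
have [z Az] := Zgen A (WDomega_minimal_closed Kdir cK cA KA Amin).
have Az' : A = closure [set z].
  by rewrite -((generic_pointE A z).2 Az); apply/closure_id.
have : A z by rewrite Az'; exact: subset_closure.
move=> /AU; apply; apply: KU => i _; have [x [Kx Ax]] := KA i.
have [_ _ sK] := Kcs i.
by apply: saturated_closure1 sK Kx _; rewrite -Az'.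
Qed.

(** * The space of WD-sets and the universal property *)

Section Reflection.
Variable X : topologicalType.

Lemma open_Diamond (U : set X) : open U -> open (Diamond U).
Proof. by move=> oU; exists U. Qed.

Lemma open_DiamondP (V : set (PH_WDomega X)) :
  open V -> exists2 U, open U & V = Diamond U.
Proof. by move=> [U oU <-]; exists U. Qed.

Lemma Diamond_etaP (U : set X) (x : X) : open U -> Diamond U (eta x) <-> U x.
Proof.
move=> oU; split=> [|Ux]; first exact: closure1_meets_open.
by exists x; split=> //; exact: subset_closure.
Qed.

Lemma continuous_eta : continuous (@eta X).
Proof.
apply/continuousP => _ /open_DiamondP[U oU ->].
suff -> : @eta X @^-1` Diamond U = U by [].
by apply/seteqP; split=> x /(Diamond_etaP _ oU).
Qed.

Lemma PH_WDomega_kolmogorov : kolmogorov_space (PH_WDomega X).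
Proof.
have sep (A B : PH_WDomega X) : ~ sval A `<=` sval B ->
    exists2 V, open_nbhs A V & ~ V B.
  have /set_mem[cB _] := svalP B.
  move=> /existsNP[x /not_implyP[Ax nBx]]; exists (Diamond (~` sval B)).
    by split; [apply: open_Diamond; rewrite openC|exists x].
  by move=> [z []].
move=> A B /eqP AB; have [sAB|/sep[V AV nVB]] := pselect (sval A `<=` sval B).
  have [sBA|/sep[V BV nVA]] := pselect (sval B `<=` sval A).
    exfalso; apply: AB; case: A B sAB sBA => A WA [B WB] /= sAB sBA.
    by apply: eq_exist; apply/seteqP.
  by exists V; right; rewrite !inE; split=> //; exact: open_nbhs_nbhs.
by exists V; left; rewrite !inE; split=> //; exact: open_nbhs_nbhs.
Qed.

Lemma extensionP (Y : topologicalType) (f : X -> Y) :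
  omega_well_filtered Y -> continuous f ->
  exists g : PH_WDomega X -> Y, forall A, generic_point (f @` sval A) (g A).
Proof.
move=> wfY cf.
have [|g gP] := @choice _ _ (fun A : PH_WDomega X => generic_point (f @` sval A)).
  by move=> A; have /set_mem/WDomegaP[_] := svalP A; exact.
by exists g.
Qed.

(** The identity [g @^-1` V = Diamond (f @^-1` V)] carries both the continuity
    of the extension and its agreement with [f] along [eta]. *)
Lemma preimage_extension (Y : topologicalType) (f : X -> Y)
    (g : PH_WDomega X -> Y) (V : set Y) :
  (forall A, generic_point (f @` sval A) (g A)) -> open V ->
  g @^-1` V = Diamond (f @^-1` V).
Proof.
move=> gP oV; apply/seteqP; split=> A.
  by move=> /(gP A V oV)/meets_imageP.
by move=> AV; apply/(gP A V oV)/meets_imageP.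
Qed.

Lemma continuous_extension (Y : topologicalType) (f : X -> Y)
    (g : PH_WDomega X -> Y) :
  continuous f -> (forall A, generic_point (f @` sval A) (g A)) ->
  continuous g.
Proof.
move=> /continuousP cf gP; apply/continuousP => V oV.
by rewrite (preimage_extension gP oV); apply: open_Diamond; exact: cf.
Qed.

Lemma extension_eta (Y : topologicalType) (f : X -> Y)
    (g : PH_WDomega X -> Y) :
  kolmogorov_space Y -> continuous f ->
  (forall A, generic_point (f @` sval A) (g A)) -> g \o @eta X = f.
Proof.
move=> T0 /continuousP cf gP; apply/funext => x.
apply: kolmogorov_open_inj => // V oV.
have := Diamond_etaP x (cf V oV).
by rewrite -(preimage_extension gP oV).
Qed.

(** This gives the uniqueness of extensions. The preimage of [V] by [g] is some
    [Diamond U], and [U] is the preimage of [Diamond U] by [eta], so that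
    [g @^-1` V] is determined by [g \o eta]. *)
Lemma extension_generic_point (Y : topologicalType) (g : PH_WDomega X -> Y)
    (A : PH_WDomega X) :
  continuous g -> generic_point ((g \o @eta X) @` sval A) (g A).
Proof.
move=> /continuousP cg V oV; have [U oU gU] := open_DiamondP (cg V oV).
have -> : V (g A) = Diamond U A by rewrite -gU.
rewrite meets_imageP comp_preimage gU.
suff -> : @eta X @^-1` Diamond U = U by [].
by apply/seteqP; split=> x /(Diamond_etaP _ oU).
Qed.

(** For an extension [g] of [f], an open set [V] meets [g @` AA] exactly when
    [f @^-1` V] meets some member of [AA], that is, when [V] meets the image of
    the union; so a generic point of [g @` AA] is one of the latter image too. *)
Lemma WDomega_bigcup (AA : set (PH_WDomega X)) :
  WDomega (PH_WDomega X) AA -> WDomega X (closure (\bigcup_(A in AA) sval A)).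
Proof.
move=> /WDomegaP[_ WA]; apply/WDomegaP; split; first exact: closed_closure.
move=> Y wfY f cf; have [g gP] := extensionP wfY cf.
have [y gy] := WA Y wfY g (continuous_extension cf gP).
exists y => V oV; rewrite -gy // !meets_imageP (preimage_extension gP oV).
split=> [/closure_meets_open|[A [AAA [x [Ax Vx]]]]].
  have/continuousP cf' := cf.
  by move=> /(_ (cf' V oV))[x [[A AAA Ax] Vx]]; exists A; split=> //; exists x.
by exists x; split=> //; apply: subset_closure; exists A.
Qed.

(** The closure of the union meets [U] exactly when some member of [AA] does,
    which says that it is the generic point of [AA] in the lower Vietoris
    topology. *)
Lemma PH_WDomega_generic_points (AA : set (PH_WDomega X)) :
  WDomega (PH_WDomega X) AA -> exists A, generic_point AA A.
Proof.
move=> WA; pose B : PH_WDomega X :=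
  exist (fun A => is_true (A \in WDomega X)) _ (mem_set (WDomega_bigcup WA)).
exists B => _ /open_DiamondP[U oU ->].
split=> [[A [AAA [x [Ax Ux]]]]|].
  by exists x; split=> //; apply: subset_closure; exists A.
move=> /(closure_meets_open oU)[x [[A AAA Ax] Ux]].
by exists A; split=> //; exists x.
Qed.

End Reflection.

Theorem theorem6p8 (X : topologicalType) (T0X : kolmogorov_space X) :
  @omega_well_filtered_reflection X (PH_WDomega X) (@eta X).
Proof.
split.
- apply: omega_well_filtered_of_generic_points.
    exact: PH_WDomega_kolmogorov.
  exact: PH_WDomega_generic_points.
- exact: continuous_eta.
move=> Y wfY f cf; have [g gP] := extensionP wfY cf.
have T0Y := wfY.1.
exists g; split=> [|h [ch hf]].
  by split; [exact: continuous_extension gP|exact: extension_eta gP].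
apply/funext => A; apply: generic_point_unique (gP A) _ => //.
by rewrite -hf; exact: extension_generic_point.
Qed.
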